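(* Let $d\ge 1$, let $\mu$ be an ergodic translation-invariant probability measure on $\{0,1\}^{\mathbb{Z}^d}$, let $\Gamma$ have law $\mu$, and suppose $p=\mu(\Gamma(0)=1)\in(0,1)$. Then: (i) For all such $d,\mu$, there exists an extra head scheme for $\Gamma$. (ii) For all such $d,\mu$, there exists a nonrandomized extra head scheme for $\Gamma$ if and only if $p$ is the reciprocal of an integer. (iii) For all such $d,\mu$ and any shift coupling $(\Gamma,\Gamma^*,X)$, i.e. random elements on a common probability space such that $\Gamma$ has law $\mu$, $\Gamma^*$ has law $\mu^*$, $X$ is $\mathbb{Z}^d$-valued and $\Gamma=T^{X}\Gamma^*$ almost surely, the translation $X$ is not a function of $\Gamma^*$; that is, there is no measurable $h:\{0,1\}^{\mathbb{Z}^d}\to\mathbb{Z}^d$ with $X=h(\Gamma^* )$ almost surely.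
   Context: $\{0,1\}^{\mathbb{Z}^d}$ carries the product $\sigma$-algebra; its elements are called configurations. For $z\in\mathbb{Z}^d$ and a configuration $\gamma$, $(T^{-z}\gamma)(y)=\gamma(y+z)$. Translation-invariance and ergodicity are with respect to the group of all translations $T^z$, $z\in\mathbb{Z}^d$. $\mu^*$ denotes the conditional law of $\Gamma$ given $\Gamma(0)=1$. A (discrete) extra head scheme for $\Gamma$ is a $\mathbb{Z}^d$-valued random variable $X$ (on some joint probability space with $\Gamma$) such that the random configuration $T^{-X}\Gamma$ has law $\mu^*$. It is called nonrandomized if it is almost surely equal to a deterministic (measurable) function of $\Gamma$. *)

(* Defs.v *)
From HB Require Import structures.
From mathcomp Require Import all_boot all_order all_algebra.
From mathcomp Require Import all_classical all_reals all_analysis.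

Set Implicit Arguments.
Unset Strict Implicit.
Unset Printing Implicit Defensive.

Import Order.TTheory GRing.Theory Num.Theory.

Local Open Scope classical_set_scope.
Local Open Scope ring_scope.

Definition lattice (d : nat) : Type := 'rV[int]_d.

HB.instance Definition _ d := Countable.on (lattice d).
HB.instance Definition _ d := GRing.Zmodule.on (lattice d).
HB.instance Definition _ d := isPointed.Build (lattice d) 0.
HB.instance Definition _ d := @isMeasurable.Build default_measure_display
  (lattice d) discrete_measurable discrete_measurable0
  discrete_measurableC discrete_measurableU.

Definition cylinders (d : nat) : set (set (lattice d -> bool)) :=
  \bigcup_(z in [set: lattice d])
    preimage_set_system setT (fun g : lattice d -> bool => g z) measurable.
Arguments cylinders d _ : clear implicits.

(* {0,1}^(Z^d) with the product sigma-algebra; [true] stands for 1. *)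
Definition config (d : nat) : Type := g_sigma_algebraType (cylinders d).

(* [translate z] is T^z, so that (T^(-z) g)(y) = g (y + z). *)
Definition translate d (z : lattice d) (g : config d) : config d :=
  fun y => g (y - z).

Definition head_at0 d : set (config d) := [set g | g 0 = true].
Arguments head_at0 d _ : clear implicits.

Section Measures.
Context (R : realType) (d : nat).
Implicit Type mu : probability (config d) R.

Definition translation_invariant mu : Prop :=
  forall (z : lattice d) (A : set (config d)), measurable A ->
    mu (translate z @^-1` A) = mu A.

Definition ergodic mu : Prop :=
  forall A : set (config d), measurable A ->
    (forall z : lattice d, translate z @^-1` A = A) -> mu A = 0%E \/ mu A = 1%E.

(* The law mu* of a configuration given that it takes the value 1 at 0;
   meaningful when [mu (head_at0 d)] is nonzero. *)
Definition cond_head mu (A : set (config d)) : \bar R :=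
  (mu (A `&` head_at0 d) / mu (head_at0 d))%E.

End Measures.

Section Couplings.
Context (R : realType) (dT : measure_display) (T : measurableType dT)
        (P : probability T R).

(* The law of [X] is only compared with [nu] on measurable sets, since a
   measure is a function on all sets. *)
Definition has_law dS (S : measurableType dS) (X : T -> S)
    (nu : set S -> \bar R) : Prop :=
  measurable_fun setT X /\
  forall A : set S, measurable A -> pushforward P X A = nu A.

Context (d : nat) (mu : probability (config d) R).

Definition extra_head_scheme
    (Gamma : {RV P >-> config d}) (X : {RV P >-> lattice d}) : Prop :=
  has_law Gamma mu /\
  has_law (fun w => translate (- X w) (Gamma w)) (cond_head mu).

(* [X] is almost surely equal to a measurable deterministic function of [G]. *)
Definition function_of
    (X : {RV P >-> lattice d}) (G : {RV P >-> config d}) : Prop :=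
  exists h : config d -> lattice d,
    measurable_fun setT h /\ {ae P, forall w, X w = h (G w)}.

Definition shift_coupling (Gamma Gammas : {RV P >-> config d})
    (X : {RV P >-> lattice d}) : Prop :=
  [/\ has_law Gamma mu,
      has_law Gammas (cond_head mu) &
      {ae P, forall w, Gamma w = translate (X w) (Gammas w)}].

End Couplings.

(* Main.v *)
Require Import Defs.
From HB Require Import structures.
From mathcomp Require Import all_boot all_order all_algebra.
From mathcomp Require Import all_classical all_reals all_analysis.
From mathcomp Require Import measurable_realfun.

(** Everything rests on mass transport. If every site sends to every other site
    a mass depending measurably on the configuration seen from the sender, then
    by translation invariance the expected mass leaving the origin equals the
    expected mass arriving there, also when one counts only the mass whose
    destination sees the configuration in a given event
    ([integral_restrict_translate], for one displacement).

    Necessity in (ii), and (iii).  Let [k] be a measurable lattice-valued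
    function of the configuration [g], and let each site at which the event [B]
    occurs jump by minus its own value of [k].  The measure of the [g] in [B]
    such that [translate (k g) g] lies in [A] is then the integral over [A] of
    the number [arrivals] of jumps that end at the origin
    ([integral_arrivals]).  If [X = h Gamma] is an extra head scheme, taking
    [k = - h] and no restriction [B] shows that the number of arrivals is
    almost surely [1/p] times the indicator of a head at the origin; as it is
    an integer and heads have positive probability, [1/p] is an integer.  If
    [Gamma = translate (h Gammas) Gammas], taking [k = h] and for [B] the event
    of a head at the origin shows that the number of arrivals is almost surely
    the constant [p], which is impossible for an integer as [0 < p < 1].

    Existence.  Enumerate the lattice as [z 0], [z 1], and so on.  Each site
    starts with mass 1 to dispose of, each head with capacity [1/p].  At stage
    [n] every site [x] sends to [x + z n] as much of its remaining mass as the
    remaining capacity there allows; since the displacement is the same for all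
    sites, each head receives from one site only and no conflict arises.  A
    site with mass left over for ever and a head with capacity left over for
    ever cannot coexist, because the stage at which they meet exhausts one of
    them ([sent_or_received]).  The event that some site keeps some mass is
    translation invariant, so by ergodicity almost surely all mass is sent, or
    almost surely all heads are filled.  The expected initial mass and the
    expected initial capacity at the origin both equal 1, so by mass
    conservation both alternatives hold ([integral_total_sent1]).  Letting the
    origin move by [z n] with conditional probability the mass it sends at
    stage [n] gives the scheme ([greedy_scheme]).  When [1/p] is an integer all
    the masses stay integers, so that the origin sends its whole mass in one
    stage and the displacement is a function of the configuration. *)

Set Implicit Arguments.
Unset Strict Implicit.
Unset Printing Implicit Defensive.

Import Order.TTheory GRing.Theory Num.Theory.

Local Open Scope classical_set_scope.
Local Open Scope ring_scope.

(** * Measure-theoretic preliminaries *)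

Lemma measurable_preimageT d1 d2 (T1 : measurableType d1)
    (T2 : measurableType d2) (f : T1 -> T2) (A : set T2) :
  measurable_fun setT f -> measurable A -> measurable (f @^-1` A).
Proof. by move=> mf mA; rewrite -[X in measurable X]setTI; exact: mf. Qed.

Lemma probability_ae_eq (R : realType) dT (T : measurableType dT)
    (P : probability T R) (A B : set T) :
  measurable A -> measurable B -> {ae P, forall w, A w <-> B w} -> P A = P B.
Proof.
move=> mA mB [N [mN N0 sN]].
have key (C D : set T) : measurable C -> measurable D ->
    (forall w, C w -> ~ D w -> N w) -> (P C <= P D)%E.
  move=> mC mD h.
  have mDN : measurable (D `|` N) by exact: measurableU.
  apply: (@le_trans _ _ (P (D `|` N))).
    apply: le_measure; [exact/mem_set|exact/mem_set|].
    move=> w Cw; have [Dw|nDw] := pselect (D w); first by left.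
    by right; exact: h nDw.
  have U2 : (P (D `|` N) <= P D + P N)%E by exact: measureU2.
  by apply: le_trans U2 _; rewrite N0 adde0.
apply/eqP; rewrite eq_le; apply/andP; split; apply: key => // w h1 h2;
  by apply: sN => /=; tauto.
Qed.

Lemma ae_exists (R : realType) dT (T : measurableType dT)
    (P : probability T R) (H : set T) (Q : T -> Prop) :
  measurable H -> (0 < P H)%E -> {ae P, forall w, Q w} ->
  exists2 w, H w & Q w.
Proof.
move=> mH H0 [N [mN N0 sN]]; apply: contrapT => hno.
suff : (P H <= P N)%E by rewrite N0 leNgt H0.
apply: le_measure; [exact/mem_set|exact/mem_set|] => w Hw; apply: sN => /= Qw.
by apply: hno; exists w.
Qed.

(** Nonnegative functions that are ordered and have the same finite integral
    have the same integral on every measurable set. *)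
Lemma ge0_integral_subset_eq (R : realType) dT (T : measurableType dT)
    (P : probability T R) (f g : T -> \bar R) (A : set T) :
  measurable_fun setT f -> measurable_fun setT g -> measurable A ->
  (forall w, 0 <= f w)%E -> (forall w, f w <= g w)%E ->
  (\int[P]_w f w = \int[P]_w g w)%E -> (\int[P]_w g w < +oo)%E ->
  (\int[P]_(w in A) f w = \int[P]_(w in A) g w)%E.
Proof.
move=> mf mg mA f0 fg fgI gfin.
have g0 w : (0 <= g w)%E by exact: le_trans (f0 w) (fg w).
have mA' := measurableC mA.
have split h : measurable_fun setT h -> (forall w, 0 <= h w)%E ->
    (\int[P]_w h w = \int[P]_(w in A) h w + \int[P]_(w in ~` A) h w)%E.
  move=> mh h0; rewrite -ge0_integral_setU ?setUv//; last exact/disj_setPCl.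
have le B : measurable B -> (\int[P]_(w in B) f w <= \int[P]_(w in B) g w)%E.
  by move=> mB; apply: ge0_le_integral => //; exact: measurable_funTS.
apply/eqP; rewrite eq_le le//= leNgt; apply/negP => lt.
move: (fgI); apply/eqP; rewrite lt_eqF// (split f)// (split g)//.
apply: lte_leD => //; last exact: le.
rewrite ge0_fin_numE; last by apply: integral_ge0.
apply: le_lt_trans gfin; rewrite -fgI; apply: ge0_subset_integral => //.
Qed.

(** Nonnegative functions [m n] of total integral 1 are the densities of a
    probability on the points marked by an integer [n]. *)
Lemma marked_law (R : realType) dT (T : measurableType dT)
    (mu : probability T R) (m : nat -> T -> \bar R) :
  (forall n, measurable_fun setT (m n)) -> (forall n w, 0 <= m n w)%E ->
  (\sum_(n <oo) \int[mu]_w m n w = 1)%E ->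
  exists Q : probability (T * nat)%type R, forall B,
    (Q B = \sum_(n <oo) \int[mu]_(w in [set w | B (w, n)]) m n w)%E.
Proof.
move=> mm m0 m1.
pose nu n (B : set (T * nat)) : \bar R :=
  (\int[mu]_(w in [set w | B (w, n)]) m n w)%E.
have nu0 n : nu n set0 = 0%E by rewrite /nu -[RHS](integral_set0 mu (m n)).
have nu_ge0 n B : (0 <= nu n B)%E by apply: integral_ge0.
have msec n (B : set (T * nat)) : measurable B -> measurable [set w | B (w, n)].
  by move=> mB; apply: (measurable_preimageT (pair2_measurable n) mB).
have nu_add n : semi_sigma_additive (nu n).
  move=> F mF tF mUF.
  have := @semi_sigma_additive_nng_induced _ _ _ mu _ (mm n) (m0 n)
    (fun k => [set w | F k (w, n)]).
  rewrite /nu (_ : [set w | (\bigcup_k F k) (w, n)] =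
    \bigcup_k [set w | F k (w, n)])//.
  apply.
  - by move=> k; exact: msec.
  - apply/trivIsetP => i j _ _ ij; apply/seteqP; split => // w [Fi Fj].
    move/trivIsetP : tF => /(_ i j I I ij)/seteqP[/(_ (w, n)) FF _].
    exact: FF.
  - by apply: bigcupT_measurable => k; exact: msec.
pose nuM n : {measure set (T * nat) -> \bar R} :=
  HB.pack (nu n) (isMeasure.Build _ _ _ (nu n) (nu0 n) (nu_ge0 n) (@nu_add n)).
have QT : mseries nuM 0 setT = 1%E by rewrite /mseries -m1.
pose Q : probability (T * nat)%type R := HB.pack (mseries nuM 0)
  (Measure_isProbability.Build _ _ _ (mseries nuM 0) QT).
by exists Q.
Qed.

(** * Translations of configurations *)

Lemma translate0 d (g : config d) : translate 0 g = g.
Proof. by apply/funext => y; rewrite /translate subr0. Qed.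

Lemma translateD d (x y : lattice d) (g : config d) :
  translate x (translate y g) = translate (x + y) g.
Proof. by apply/funext => w; rewrite /translate opprD addrA. Qed.

Lemma measurable_cylinder d (z : lattice d) (b : bool) :
  measurable [set g : config d | g z = b].
Proof.
apply: sub_sigma_algebra; exists z => //.
by exists [set b] => //; rewrite setTI.
Qed.

Lemma measurable_head_at0 d : measurable (head_at0 d).
Proof. exact: measurable_cylinder. Qed.

Lemma measurable_translate d (z : lattice d) :
  measurable_fun setT (@translate d z).
Proof.
have := @measurability _ _ (config d) (config d) setT (@translate d z)
  (cylinders d); apply => //.
move=> _ [_ [y _ [B mB <-]] <-]; rewrite !setTI.
apply: sub_sigma_algebra; exists (y - z) => //.
by exists B => //; rewrite setTI.
Qed.

(** This is where the dimension must be positive: the lattice is infinite. *)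
Lemma lattice_enum d : (1 <= d)%N -> exists z : nat -> lattice d, bijective z.
Proof.
case: d => // d _.
have inj : injective (fun n : nat => const_mx n%:Z : lattice d.+1).
  by move=> m n /matrixP/(_ ord0 ord0); rewrite !mxE => -[].
have : ([set: nat] #= [set: lattice d.+1])%card.
  rewrite card_eq_sym; apply: eq_card_nat; first exact: countableP.
  by apply/infiniteP/pcard_injP; exists (fun n => const_mx n%:Z)
    => m n _ _ /inj.
by move=> /card_set_bijP[f fbij]; exists f; rewrite -setTT_bijective.
Qed.

(** Substituting a lattice-valued random variable for a parameter preserves
    measurability, the lattice being countable. *)
Lemma measurable_comp_lattice d d' (T : measurableType d') (h : T -> lattice d)
  d2 (T2 : measurableType d2) (F : lattice d -> T -> T2) :
  measurable_fun setT h -> (forall x, measurable_fun setT (F x)) ->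
  measurable_fun setT (fun w => F (h w) w).
Proof.
move=> mh mF _ A mA; rewrite setTI.
rewrite (_ : _ @^-1` _ = \bigcup_(x in [set: lattice d])
    ((h @^-1` [set x]) `&` (F x @^-1` A))).
  apply: countable_bigcupT_measurable => [|x]; first exact: countableP.
  apply: measurableI; first by rewrite -[X in measurable X]setTI; apply: mh.
  by rewrite -[X in measurable X]setTI; apply: mF.
by apply/seteqP; split => [w Aw|w [x _ [/= -> ]]]//; exists (h w).
Qed.

Lemma measurable_preimage_translate d (k : config d -> lattice d)
    (A : set (config d)) : measurable_fun setT k -> measurable A ->
  measurable [set g | A (translate (k g) g)].
Proof.
move=> mk mA; rewrite -[X in measurable X]setTI.
apply: (@measurable_comp_lattice _ _ (config d) k _ (config d) (@translate d))
  => //.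
exact: measurable_translate.
Qed.

Lemma measurable_selection dT (T : measurableType dT) d (z : nat -> lattice d)
    (S : nat -> set T) :
  (forall n, measurable (S n)) ->
  (forall i j w, S i w -> S j w -> i = j) ->
  exists2 h : T -> lattice d, measurable_fun setT h &
    forall n w, S n w -> h w = z n.
Proof.
move=> mS uS.
(* the value 0 outside the [S n] is arbitrary *)
pose h w : lattice d :=
  if pselect (exists n, S n w) is left e then z (projT1 (cid e)) else 0.
have hE n w : S n w -> h w = z n.
  move=> Sw; rewrite /h; case: pselect => [e|[]]; last by exists n.
  by congr z; apply: uS Sw; exact: (projT2 (cid e)).
exists h => // _ A _; rewrite setTI.
have mcst (Q : Prop) : measurable [set _ : T | Q].
  have [q|nq] := pselect Q.
    by rewrite (_ : [set _ | Q] = setT)//; apply/seteqP; split.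
  by rewrite (_ : [set _ | Q] = set0)//; apply/seteqP; split.
rewrite (_ : h @^-1` A = (\bigcup_n (S n `&` [set _ | A (z n)])) `|`
    (~` (\bigcup_n S n) `&` [set _ | A 0])).
  apply: measurableU.
    by apply: bigcupT_measurable => n; apply: measurableI.
  by apply: measurableI => //; apply: measurableC; exact: bigcupT_measurable.
apply/seteqP; split => w.
- rewrite /= /h; case: pselect => [e|ne] Ah.
    left; exists (projT1 (cid e)) => //; split => //.
    exact: (projT2 (cid e)).
  by right; split => // -[n _ Sw]; apply: ne; exists n.
- move=> [[n _ [Sw /= Az]]|[nS /= A0]]; first by rewrite /= (hE _ _ Sw).
  rewrite /= /h; case: pselect => // e; exfalso; apply: nS.
  by exists (projT1 (cid e)) => //; exact: (projT2 (cid e)).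
Qed.

Lemma cond_headE (R : realType) d (mu : probability (config d) R) (p : R) :
  mu (head_at0 d) = p%:E -> p != 0 -> forall A,
  cond_head mu A = (p^-1%:E * mu (A `&` head_at0 d))%E.
Proof. by move=> mup p0 A; rewrite /cond_head mup inver (negbTE p0) muleC. Qed.

(** * Mass transport *)

Lemma integral_translate (R : realType) d (mu : probability (config d) R) :
  translation_invariant mu -> forall (x : lattice d) (f : config d -> \bar R),
  measurable_fun [set: config d] f -> (forall g, 0 <= f g)%E ->
  (\int[mu]_g f (translate x g) = \int[mu]_g f g)%E.
Proof.
move=> hinv x f mf f0.
have := @ge0_integral_pushforward _ _ _ _ R (translate x)
  (measurable_translate x) mu setT f measurableT mf (fun y _ => f0 y).
rewrite preimage_setT => <-.
apply: eq_measure_integral; first exact: measurable_translate.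
by move=> mt A mA _; exact: hinv.
Qed.

(** If every site [y] sends the mass [f] of the configuration seen from [y] to
    [y - x], then the mass sent from the origin when the configuration seen
    from [- x] is in [A] balances the mass received at the origin when the
    configuration is in [A]. *)
Lemma integral_restrict_translate (R : realType) d
    (mu : probability (config d) R) :
  translation_invariant mu -> forall (x : lattice d) (f : config d -> \bar R)
    (A : set (config d)),
  measurable A -> measurable_fun [set: config d] f -> (forall g, 0 <= f g)%E ->
  (\int[mu]_(g in translate x @^-1` A) f g =
   \int[mu]_(g in A) f (translate (- x)%R g))%E.
Proof.
move=> hinv x f A mA mf f0.
rewrite integral_mkcond [RHS]integral_mkcond.
rewrite -[RHS](@integral_translate _ _ _ hinv x).
- apply: eq_integral => g _; rewrite /patch /=.
  by rewrite translateD addNr translate0; congr (if _ then _ else _);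
    apply/idP/idP; rewrite !inE.
- apply/(measurable_restrict _ mA measurableT); rewrite setTI.
  apply: measurable_funTS; apply: measurableT_comp mf _.
  exact: measurable_translate.
- by move=> g; rewrite /patch; case: ifP.
Qed.

(** The number of indices [n] such that the configuration
    [translate (- z n) g] lies in [B] and its value of [k] is [z n], so that
    it is translated back to [g] by that value. *)
Definition arrivals (R : realType) d (z : nat -> lattice d)
    (k : config d -> lattice d) (B : set (config d)) (g : config d) : \bar R :=
  (\sum_(n <oo) (\1_(B `&` k @^-1` [set z n]) (translate (- z n)%R g))%:E)%E.

Lemma arrivals_nat (R : realType) d z k B g (r : R) :
  @arrivals R d z k B g = r%:E -> exists m : nat, r = m%:R.
Proof.
rewrite /arrivals.
pose S := [set n | (B `&` k @^-1` [set z n]) (translate (- z n)%R g)].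
have -> : (\sum_(n <oo)
             (\1_(B `&` k @^-1` [set z n]) (translate (- z n)%R g))%:E
           = counting S :> \bar R)%E.
  rewrite counting_dirac; apply: eq_eseriesr => n _.
  by rewrite diracE indicE.
by rewrite /counting; case: ifP => // _ [<-]; eexists.
Qed.

Lemma measurable_arrivals (R : realType) d z k B :
  measurable B -> measurable_fun setT k ->
  measurable_fun setT (@arrivals R d z k B).
Proof.
move=> mB mk; apply: ge0_emeasurable_sum => // n _.
apply/measurable_EFinP.
apply: (@measurableT_comp _ _ _ _ _ _
    (\1_(B `&` k @^-1` [set z n]) : config d -> R)).
  apply: measurable_indic; apply: measurableI => //.
  by rewrite -[X in measurable X]setTI; exact: mk.
exact: measurable_translate.
Qed.

Lemma integral_arrivals (R : realType) d (mu : probability (config d) R) :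
  translation_invariant mu ->
  forall (z : nat -> lattice d) (k : config d -> lattice d)
    (A B : set (config d)),
  bijective z -> measurable_fun setT k -> measurable A -> measurable B ->
  (mu (B `&` [set g | A (translate (k g) g)]) =
   \int[mu]_(g in A) arrivals R z k B g)%E.
Proof.
move=> hinv z k A B [z' zK z'K] mk mA mB.
have mBk n : measurable (B `&` k @^-1` [set z n]).
  by apply: measurableI => //; rewrite -[X in measurable X]setTI; exact: mk.
rewrite /arrivals integral_nneseries //; last first.
  move=> n; apply: measurable_funTS; apply/measurable_EFinP.
  apply: (@measurableT_comp _ _ _ _ _ _
    (\1_(B `&` k @^-1` [set z n]) : config d -> R)).
    exact: measurable_indic.
  exact: measurable_translate.
have mtr n : measurable (translate (z n) @^-1` A).
  by rewrite -[X in measurable X]setTI; exact: measurable_translate.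
rewrite (_ : B `&` _ =
  \bigcup_n (B `&` k @^-1` [set z n] `&` translate (z n) @^-1` A)); last first.
  apply/seteqP; split => [g [Bg Ag]|g [n _ [[Bg kg] /= Ag]]].
    by exists (z' (k g)) => //=; split; rewrite /= z'K.
  by split=> //=; rewrite kg.
rewrite measure_semi_bigcup; last 3 first.
- by move=> n; apply: measurableI.
- apply/trivIsetP => i j _ _ ij; apply/seteqP; split=> // g.
  move=> [[[_ /= ki] _] [[_ /= kj] _]].
  by move: ij; rewrite -(inj_eq (can_inj zK)) -ki -kj eqxx.
- by apply: bigcupT_measurable => n; apply: measurableI.
apply: eq_eseriesr => n _.
rewrite -(@integral_restrict_translate _ _ _ hinv (z n)
  (fun g => (\1_(B `&` k @^-1` [set z n]) g)%:E))//.
- by rewrite integral_indic.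
- by apply/measurable_EFinP; exact: measurable_indic.
Qed.

(** * Displacements that are functions of a configuration *)

Lemma reciprocal_of_function (R : realType) d (hd : (1 <= d)%N)
    (mu : probability (config d) R) (hinv : translation_invariant mu) (p : R)
    (mup : mu (head_at0 d) = p%:E) (p0 : 0 < p)
    dT (T : measurableType dT) (P : probability T R)
    (Gamma : {RV P >-> config d}) (X : {RV P >-> lattice d}) :
  extra_head_scheme mu Gamma X -> function_of X Gamma ->
  exists m : nat, p^-1 = m%:R.
Proof.
move=> [[mG lawG] [mX lawX]] [h [mh aeX]].
have [z zbij] := lattice_enum hd.
(* [integral_arrivals] translates by [k], the scheme by [- h Gamma] *)
pose k g := - h g.
have mk : measurable_fun setT k by apply: measurableT_comp mh => //.
have eqA (A : set (config d)) : measurable A ->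
    (\int[mu]_(g in A) (p^-1%:E * (\1_(head_at0 d) g)%:E)%E =
     \int[mu]_(g in A) arrivals R z k setT g)%E.
  move=> mA; rewrite -(integral_arrivals hinv zbij mk mA measurableT) setTI.
  rewrite -lawG; last exact: measurable_preimage_translate.
  rewrite ge0_integralZl//; last first.
  - by rewrite lee_fin invr_ge0 ltW.
  - by apply/measurable_EFinP; apply: measurable_indic;
      exact: measurable_head_at0.
  rewrite integral_indic//; last exact: measurable_head_at0.
  rewrite setIC -(cond_headE mup) ?gt_eqF// -lawX//.
  apply: probability_ae_eq.
  - exact: measurable_preimageT mX mA.
  - apply: measurable_preimageT mG _; exact: measurable_preimage_translate.
  - by apply: filterS aeX => w /= ->.
have : ae_eq mu setT (fun g => (p^-1%:E * (\1_(head_at0 d) g)%:E)%E)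
    (arrivals R z k setT).
  apply: integral_ae_eq => //.
  - by apply: integrableZl => //; apply: integrable_indic;
       exact: measurable_head_at0.
  - exact: measurable_arrivals.
  - by move=> E _ mE; exact: eqA.
have H0 : (0 < mu (head_at0 d))%E by rewrite mup lte_fin.
move=> aeN; have [g Hg] := ae_exists (@measurable_head_at0 d) H0 aeN.
move=> /(_ I)/esym/arrivals_nat[m].
by rewrite indicE mem_set// mulr1 => -> ; exists m.
Qed.

Lemma not_function_of_shift (R : realType) d (hd : (1 <= d)%N)
    (mu : probability (config d) R) (hinv : translation_invariant mu) (p : R)
    (mup : mu (head_at0 d) = p%:E) (p0 : 0 < p) (p1 : p < 1)
    dT (T : measurableType dT) (P : probability T R)
    (Gamma Gammas : {RV P >-> config d}) (X : {RV P >-> lattice d}) :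
  shift_coupling mu Gamma Gammas X -> ~ function_of X Gammas.
Proof.
move=> [[mG lawG] [mGs lawGs] aeG] [h [mh aeX]].
have [z zbij] := lattice_enum hd.
have mH := @measurable_head_at0 d.
have eqA (A : set (config d)) : measurable A ->
    (\int[mu]_(g in A) p%:E =
     \int[mu]_(g in A) arrivals R z h (head_at0 d) g)%E.
  move=> mA; rewrite -(integral_arrivals hinv zbij mh mA mH).
  transitivity (p%:E * mu A)%E; first exact: integral_cst.
  have -> : mu A = cond_head mu [set g | A (translate (h g) g)].
    rewrite -lawG// -lawGs; last exact: measurable_preimage_translate.
    apply: probability_ae_eq.
    - exact: measurable_preimageT mG mA.
    - apply: measurable_preimageT mGs _; exact: measurable_preimage_translate.
    - by near=> w => /=; rewrite (near aeG w)// (near aeX w).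
  by rewrite (cond_headE mup) ?gt_eqF// muleA -EFinM
    mulfV ?gt_eqF// mul1e setIC.
have : ae_eq mu setT (cst p%:E) (arrivals R z h (head_at0 d)).
  apply: integral_ae_eq => //.
  - exact: finite_measure_integrable_cst.
  - exact: measurable_arrivals.
  - by move=> E _ mE; exact: eqA.
have T0 : (0 < mu setT)%E by rewrite probability_setT.
move=> aeN; have [g _] := ae_exists measurableT T0 aeN.
move=> /(_ I)/esym/arrivals_nat[m].
rewrite /= => pm; move: p0 p1; rewrite pm ltr0n ltrn1.
by case: m {pm}.
Unshelve. all: end_near.
Qed.

(** * The greedy transport *)

(** The pair made of the mass that the origin still has to send, and of the
    capacity of the origin that is still free, before stage [n].  At stage
    [n] the origin sends mass to [z n] and receives mass from [- z n]; the
    configuration seen from a site [x] is [translate (- x) g]. *)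
Fixpoint greedy (R : realType) d (z : nat -> lattice d) (K : R) (n : nat) :
    (config d -> R) * (config d -> R) :=
  if n is n'.+1 then
    let uc := greedy z K n' in
    (fun g => uc.1 g - Num.min (uc.1 g) (uc.2 (translate (- z n') g)),
     fun g => uc.2 g - Num.min (uc.1 (translate (z n') g)) (uc.2 g))
  else (fun=> 1, fun g => K * \1_(head_at0 d) g).

(** The mass left at the origin before stage [n]. *)
Definition unsent (R : realType) d (z : nat -> lattice d) (K : R) n :=
  (greedy z K n).1.

(** The capacity left at the origin before stage [n]; initially [K] at a head
    and 0 elsewhere. *)
Definition capacity (R : realType) d (z : nat -> lattice d) (K : R) n :=
  (greedy z K n).2.

(** The mass sent from the origin to [z n] at stage [n]. *)
Definition sent (R : realType) d (z : nat -> lattice d) (K : R) n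
    (g : config d) : R :=
  Num.min (unsent z K n g) (capacity z K n (translate (- z n) g)).

Section greedy_theory.
Context (R : realType) (d : nat) (z : nat -> lattice d) (K : R).
Hypothesis K0 : 0 <= K.

Local Notation unsent := (unsent z K).
Local Notation capacity := (capacity z K).
Local Notation sent := (sent z K).

Lemma unsentS n g : unsent n.+1 g = unsent n g - sent n g.
Proof. by []. Qed.

Lemma sent_translate n g :
  sent n (translate (z n) g) =
  Num.min (unsent n (translate (z n) g)) (capacity n g).
Proof. by rewrite /sent translateD addNr translate0. Qed.

Lemma capacityS n g :
  capacity n.+1 g = capacity n g - sent n (translate (z n) g).
Proof. by rewrite sent_translate. Qed.

Lemma unsent_ge0 n g : 0 <= unsent n g.
Proof.
by case: n => [|n]; rewrite ?ler01// unsentS subr_ge0 /sent ge_min lexx.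
Qed.

Lemma capacity_ge0 n g : 0 <= capacity n g.
Proof.
case: n => [|n]; first by rewrite mulr_ge0.
by rewrite capacityS sent_translate subr_ge0 ge_min lexx orbT.
Qed.

Lemma sent_ge0 n g : 0 <= sent n g.
Proof. by rewrite le_min unsent_ge0 capacity_ge0. Qed.

Lemma measurable_greedy n :
  measurable_fun [set: config d] (unsent n) /\
  measurable_fun [set: config d] (capacity n).
Proof.
elim: n => [|n [mu mc]].
  split; first exact: measurable_cst.
  apply: measurable_funM; first exact: measurable_cst.
  by apply: measurable_indic; exact: measurable_head_at0.
split; apply: measurable_funB => //; apply: measurable_minr => //.
  by apply: measurableT_comp mc _; exact: measurable_translate.
by apply: measurableT_comp mu _; exact: measurable_translate.
Qed.

Lemma measurable_sent n : measurable_fun [set: config d] (sent n).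
Proof.
have [mu mc] := measurable_greedy n.
apply: measurable_minr => //.
by apply: measurableT_comp mc _; exact: measurable_translate.
Qed.

Lemma sum_sent n g : \sum_(i < n) sent i g = 1 - unsent n g.
Proof.
elim: n => [|n IH]; first by rewrite big_ord0 subrr.
by rewrite big_ord_recr/= IH unsentS opprB addrA addrAC.
Qed.

Lemma sum_received n g : \sum_(i < n) sent i (translate (z i) g) =
  K * \1_(head_at0 d) g - capacity n g.
Proof.
elim: n => [|n IH]; first by rewrite big_ord0 subrr.
by rewrite big_ord_recr/= IH capacityS opprB addrA addrAC.
Qed.

(** The mass that leaves the origin over all stages. *)
Definition total_sent (g : config d) : \bar R :=
  (\sum_(n <oo) (sent n g)%:E)%E.

(** The mass that arrives at the origin over all stages. *)
Definition total_received (g : config d) : \bar R :=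
  (\sum_(n <oo) (sent n (translate (z n) g))%:E)%E.

Lemma total_sent_ge n g : ((1 - unsent n g)%:E <= total_sent g)%E.
Proof.
rewrite -sum_sent -sumEFin -(big_mkord xpredT (fun i => (sent i g)%:E)).
by apply: nneseries_lim_ge => i _ _; rewrite lee_fin sent_ge0.
Qed.

Lemma total_received_ge n g :
  ((K * \1_(head_at0 d) g - capacity n g)%:E <= total_received g)%E.
Proof.
rewrite -sum_received -sumEFin.
rewrite -(big_mkord xpredT (fun i => (sent i (translate (z i) g))%:E)).
by apply: nneseries_lim_ge => i _ _; rewrite lee_fin sent_ge0.
Qed.

Lemma total_sent_le1 g : (total_sent g <= 1)%E.
Proof.
apply: lime_le.
  by apply: is_cvg_nneseries => i _ _; rewrite lee_fin sent_ge0.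
apply: nearW => n; rewrite big_mkord sumEFin sum_sent lee_fin.
by rewrite gerBl unsent_ge0.
Qed.

Lemma total_received_le g : (total_received g <= (K * \1_(head_at0 d) g)%:E)%E.
Proof.
apply: lime_le.
  by apply: is_cvg_nneseries => i _ _; rewrite lee_fin sent_ge0.
apply: nearW => n; rewrite big_mkord sumEFin sum_received lee_fin.
by rewrite gerBl capacity_ge0.
Qed.

(** The sites [- x] and [- y] cannot have respectively mass and capacity left
    over for ever, since one of the two is exhausted at the stage of
    displacement [x - y]. *)
Lemma sent_or_received x y g : (forall v, exists n, z n = v) ->
  total_sent (translate x g) = 1%E \/
  total_received (translate y g) = (K * \1_(head_at0 d) (translate y g))%:E.
Proof.
move=> zsurj; have [n zn] := zsurj (x - y).
have [u0|c0] : unsent n.+1 (translate x g) = 0 \/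
               capacity n.+1 (translate y g) = 0.
  have xE : translate (z n) (translate y g) = translate x g.
    by rewrite translateD zn subrK.
  rewrite unsentS capacityS sent_translate xE.
  have -> : sent n (translate x g) =
      Num.min (unsent n (translate x g)) (capacity n (translate y g)).
    by rewrite -xE sent_translate.
  by case: leP => _; rewrite subrr; [left|right].
- left; apply/eqP; rewrite eq_le total_sent_le1/=.
  by have := total_sent_ge n.+1 (translate x g); rewrite u0 subr0.
- right; apply/eqP; rewrite eq_le total_received_le/=.
  by have := total_received_ge n.+1 (translate y g); rewrite c0 subr0.
Qed.

Lemma measurable_total_sent : measurable_fun [set: config d] total_sent.
Proof.
apply: ge0_emeasurable_sum => [n g _ _|n _]; first by rewrite lee_fin sent_ge0.
by apply/measurable_EFinP; exact: measurable_sent.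
Qed.

Lemma measurable_received n :
  measurable_fun [set: config d] (fun g => (sent n (translate (z n) g))%:E).
Proof.
apply/measurable_EFinP; apply: measurableT_comp (measurable_sent n) _.
exact: measurable_translate.
Qed.

Lemma measurable_total_received :
  measurable_fun [set: config d] total_received.
Proof.
apply: ge0_emeasurable_sum => [n g _ _|n _]; first by rewrite lee_fin sent_ge0.
exact: measurable_received.
Qed.

Lemma total_sent_ge0 g : (0 <= total_sent g)%E.
Proof. by apply: nneseries_ge0 => n _ _; rewrite lee_fin sent_ge0. Qed.

Lemma total_received_ge0 g : (0 <= total_received g)%E.
Proof. by apply: nneseries_ge0 => n _ _; rewrite lee_fin sent_ge0. Qed.

Context (mu : probability (config d) R).
Hypothesis hinv : translation_invariant mu.

Lemma integral_total_sent (A : set (config d)) : measurable A ->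
  (\int[mu]_(g in A) total_sent g =
   \sum_(n <oo) \int[mu]_(g in A) (sent n g)%:E)%E.
Proof.
move=> mA; apply: integral_nneseries => //.
  by move=> n; apply: measurable_funTS; apply/measurable_EFinP;
    exact: measurable_sent.
by move=> n g _; rewrite lee_fin sent_ge0.
Qed.

Lemma integral_total_received (A : set (config d)) : measurable A ->
  (\int[mu]_(g in A) total_received g =
   \sum_(n <oo) \int[mu]_(g in translate (- z n)%R @^-1` A) (sent n g)%:E)%E.
Proof.
move=> mA; rewrite /total_received integral_nneseries.
- apply: eq_eseriesr => n _.
  rewrite (@integral_restrict_translate _ _ _ hinv _
    (fun g => (sent n g)%:E))//.
  + by rewrite opprK.
  + by apply/measurable_EFinP; exact: measurable_sent.
  + by move=> g; rewrite lee_fin sent_ge0.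
- exact: mA.
- by move=> n; apply: measurable_funTS; exact: measurable_received.
- by move=> n g _; rewrite lee_fin sent_ge0.
Qed.

Lemma mass_conservation :
  (\int[mu]_g total_sent g = \int[mu]_g total_received g)%E.
Proof.
by rewrite integral_total_sent// integral_total_received.
Qed.

End greedy_theory.

(** With an integer capacity all masses remain integers. *)
Lemma greedy_nat (R : realType) d (z : nat -> lattice d) (k : nat) n g :
  (unsent z (k%:R : R) n g = 0 \/ unsent z (k%:R : R) n g = 1) /\
  exists c : nat, capacity z (k%:R : R) n g = c%:R.
Proof.
have minP (u : R) (c : nat) : u = 0 \/ u = 1 ->
    (u - Num.min u c%:R = 0 \/ u - Num.min u c%:R = 1) /\
    exists c', c%:R - Num.min u c%:R = c'%:R.
  move=> [|] ->.
    by rewrite min_l// !subr0; split; [left|exists c].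
  case: c => [|c]; first by rewrite min_r// !subr0; split; [right|exists 0%N].
  by rewrite min_l ?ler1n// subrr; split; [left|exists c; rewrite -natr1 addrK].
elim: n g => [|n IH] g.
  split; first by right.
  rewrite /capacity/= indicE; exists (k * (g \in head_at0 d))%N.
  by rewrite natrM.
split.
- have [c cE] := (IH (translate (- z n) g)).2.
  by rewrite unsentS /sent cE; exact: (minP _ c (IH g).1).1.
- have [c cE] := (IH g).2.
  rewrite capacityS sent_translate cE.
  exact: (minP _ c (IH (translate (z n) g)).1).2.
Qed.

(** With an integer capacity the mass of the origin is sent in one piece. *)
Lemma sent_nat_uniq (R : realType) d (z : nat -> lattice d) (k : nat) i j g :
  sent z (k%:R : R) i g != 0 -> sent z (k%:R : R) j g != 0 -> i = j.
Proof.
have K0 : 0 <= k%:R :> R by [].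
have noninc n l : unsent z (k%:R : R) (n + l)%N g <= unsent z (k%:R : R) n g.
  elim: l => [|l IH]; first by rewrite addn0.
  rewrite addnS unsentS; apply: le_trans IH.
  by rewrite gerBl; exact: sent_ge0.
have no n l : (n < l)%N ->
    sent z (k%:R : R) n g != 0 -> sent z (k%:R : R) l g = 0.
  move=> nl sn; apply/eqP; rewrite eq_le sent_ge0// andbT.
  apply: (@le_trans _ _ (unsent z (k%:R : R) l g)).
    by rewrite /sent ge_min lexx.
  rewrite -(subnKC nl); apply: le_trans (noninc _ _) _.
  have [un|un] := (greedy_nat R z k n.+1 g).1.
    by rewrite un.
  exfalso; move: sn un; rewrite unsentS.
  have [->|->] := (greedy_nat R z k n g).1.
    by rewrite sub0r => _ h; have := sent_ge0 z K0 n g;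
      rewrite -oppr_le0 h ler10.
  move=> sn; rewrite -[X in _ = X -> _](subr0 1) => /addrI/oppr_inj/eqP.
  by rewrite (negbTE sn).
move=> si sj; have [ij|ij|//] := ltngtP i j.
  by move: sj; rewrite (no i j ij si) eqxx.
by move: si; rewrite (no j i ij sj) eqxx.
Qed.

(** * Saturation under ergodicity *)

Section saturation.
Context (R : realType) (d : nat) (z : nat -> lattice d) (p : R).
Hypotheses (zsurj : forall v, exists n, z n = v) (p0 : 0 < p).
Context (mu : probability (config d) R).
Hypotheses (hinv : translation_invariant mu) (herg : ergodic mu)
  (mup : mu (head_at0 d) = p%:E).

Local Notation S := (total_sent z p^-1).
Local Notation N := (total_received z p^-1).

Let K0 : 0 <= p^-1. Proof. by rewrite invr_ge0 ltW. Qed.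

Lemma integral_demand (A : set (config d)) : measurable A ->
  (\int[mu]_(g in A) (p^-1 * \1_(head_at0 d) g)%:E = cond_head mu A)%E.
Proof.
move=> mA.
rewrite (eq_integral (fun g => p^-1%:E * (\1_(head_at0 d) g)%:E)%E); last first.
  by move=> g _; rewrite EFinM.
rewrite ge0_integralZl//; last first.
  by apply/measurable_EFinP; apply: measurable_indic;
      exact: measurable_head_at0.
rewrite integral_indic//; last exact: measurable_head_at0.
by rewrite (cond_headE mup) ?gt_eqF// setIC.
Qed.

Lemma cond_headT : cond_head mu setT = 1%E.
Proof.
by rewrite (cond_headE mup) ?gt_eqF// setTI mup -EFinM mulVf// gt_eqF.
Qed.

Let mS : measurable_fun [set: config d] S.
Proof. exact: measurable_total_sent. Qed.

Let mN : measurable_fun [set: config d] N.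
Proof. exact: measurable_total_received. Qed.

Let integral_cst1 (A : set (config d)) : measurable A ->
  (\int[mu]_(g in A) cst 1 g = mu A)%E.
Proof. by move=> mA; rewrite integral_cst// mul1e. Qed.

Let integral_cst1T : (\int[mu]_g cst 1 g = 1)%E.
Proof. by rewrite integral_cst1// probability_setT. Qed.

(** By ergodicity all the mass is sent or all the heads are filled, and mass
    conservation gives the same expectation in both cases. *)
Lemma integral_total_sent1 : (\int[mu]_g S g = 1)%E.
Proof.
(* the event that some site keeps mass for ever *)
pose E := \bigcup_(x in [set: lattice d]) [set g | S (translate x g) < 1]%E.
have mE : measurable E.
  apply: countable_bigcupT_measurable => [|x]; first exact: countableP.
  have -> : [set g | S (translate x g) < 1]%E =
            setT `&` [set g | S (translate x g) < 1]%E by rewrite setTI.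
  apply: emeasurable_fun_lt => //.
  by apply: measurableT_comp mS _; exact: measurable_translate.
have invE x : translate x @^-1` E = E.
  apply/seteqP; split => g [y _ /= h].
    by exists (y + x) => //=; rewrite -translateD.
  by exists (y - x) => //=; rewrite translateD subrK.
have S_not_E g : ~ E g -> S g = 1%E.
  move=> nE; apply/eqP; rewrite eq_le total_sent_le1//= leNgt.
  by apply/negP => lt; apply: nE; exists 0 => //=; rewrite translate0.
have N_E g : E g -> N g = (p^-1 * \1_(head_at0 d) g)%:E.
  move=> [x _ /= lt].
  have [|] := sent_or_received K0 x 0 g zsurj; last by rewrite translate0.
  by move=> h; move: lt; rewrite h ltxx.
have [E0|E1] := herg mE invE.
- rewrite -integral_cst1T.
  apply: ge0_ae_eq_integral => //; first by move=> g _; exact: total_sent_ge0.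
  by exists E; split => // g /= h; apply: contrapT => /S_not_E.
- rewrite (mass_conservation _ K0 hinv) -cond_headT -integral_demand//.
  apply: ge0_ae_eq_integral => //.
  + apply/measurable_EFinP; apply: measurable_funM => //.
    by apply: measurable_indic; exact: measurable_head_at0.
  + by move=> g _; exact: total_received_ge0.
  + by move=> g _; rewrite lee_fin mulr_ge0.
  + exists (~` E); split; first exact: measurableC.
      have EC : (mu (~` E) = 1 - mu E)%E by exact: probability_setC.
      by rewrite E1 subee in EC.
    by move=> g /= h nE; apply: h => _; exact: N_E.
Qed.

Lemma integral_total_sent_in (A : set (config d)) : measurable A ->
  (\int[mu]_(g in A) S g = mu A)%E.
Proof.
move=> mA; rewrite -integral_cst1//.
apply: ge0_integral_subset_eq => //.
- by move=> g; exact: total_sent_ge0.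
- by move=> g; exact: total_sent_le1.
- by rewrite integral_cst1T integral_total_sent1.
- by rewrite integral_cst1T ltry.
Qed.

Lemma integral_total_received_in (A : set (config d)) : measurable A ->
  (\int[mu]_(g in A) N g = cond_head mu A)%E.
Proof.
move=> mA; rewrite -integral_demand//.
apply: ge0_integral_subset_eq => //.
- apply/measurable_EFinP; apply: measurable_funM => //.
  by apply: measurable_indic; exact: measurable_head_at0.
- by move=> g; exact: total_received_ge0.
- by move=> g; exact: total_received_le.
- by rewrite integral_demand// cond_headT -(mass_conservation _ K0 hinv)
    integral_total_sent1.
- by rewrite integral_demand// cond_headT ltry.
Qed.

End saturation.

(** * The extra head scheme *)

Section scheme.
Context (R : realType) (d : nat) (z : nat -> lattice d) (p : R).
Hypotheses (zsurj : forall v, exists n, z n = v) (p0 : 0 < p).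
Context (mu : probability (config d) R).
Hypotheses (hinv : translation_invariant mu) (herg : ergodic mu)
  (mup : mu (head_at0 d) = p%:E).

Let K0 : 0 <= p^-1. Proof. by rewrite invr_ge0 ltW. Qed.

(** The scheme given by the greedy transport, together with a criterion for its
    displacement to be a function of the configuration. *)
Lemma greedy_scheme :
  exists (dT : measure_display) (T : measurableType dT) (P : probability T R)
      (Gamma : {RV P >-> config d}) (X : {RV P >-> lattice d}),
    extra_head_scheme mu Gamma X /\
    forall h : config d -> lattice d, measurable_fun setT h ->
      (forall n g, sent z p^-1 n g != 0 -> h g = z n) -> function_of X Gamma.
Proof.
have [|||Q QE] := @marked_law R _ (config d) mu
  (fun n g => (sent z p^-1 n g)%:E).
- by move=> n; apply/measurable_EFinP; exact: measurable_sent.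
- by move=> n g; rewrite lee_fin sent_ge0.
- by rewrite -integral_total_sent//
    (integral_total_sent1 zsurj p0 hinv herg mup).
have mG : measurable_fun setT (fst : config d * nat -> config d).
  exact: measurable_fst.
have mX : measurable_fun setT (fun w : config d * nat => z w.2).
  apply: (@measurableT_comp _ _ _ _ _ _ z) => //; exact: measurable_snd.
pose Gamma : {RV Q >-> config d} := HB.pack (fst : config d * nat -> config d)
  (isMeasurableFun.Build _ _ _ _ _ mG).
pose X : {RV Q >-> lattice d} := HB.pack (fun w : config d * nat => z w.2)
  (isMeasurableFun.Build _ _ _ _ _ mX).
exists _, _, Q, Gamma, X; split; [split; split=> //|].
- move=> A mA; rewrite /pushforward QE.
  rewrite -(integral_total_sent_in zsurj p0 hinv herg mup mA).
  by rewrite integral_total_sent.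
- apply: (@measurable_comp_lattice _ _ _ (fun w => - X w) _ (config d)
    (fun x w => translate x (Gamma w))).
    by apply: (@measurableT_comp _ _ _ _ _ _ (@GRing.opp (lattice d))).
  move=> x; apply: (@measurableT_comp _ _ _ _ _ _ (translate x)) => //.
  exact: measurable_translate.
- move=> A mA; rewrite /pushforward QE.
  rewrite -(integral_total_received_in zsurj p0 hinv herg mup mA).
  by rewrite integral_total_received.
- move=> h mh hE; exists h; split => //.
  exists [set w | X w <> h (Gamma w)]; split => //.
    have mD : measurable_fun setT (fun w => h (Gamma w) - X w).
      apply: (@measurable_comp_lattice _ _ _ X _ (lattice d)
        (fun x w => h (Gamma w) - x)) => // x.
      apply: (@measurableT_comp _ _ _ _ _ _ (fun y : lattice d => y - x)) => //.
      exact: (@measurableT_comp _ _ _ _ _ _ h).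
    have := @measurable_preimageT _ _ _ (lattice d) _ [set y | y <> 0] mD I.
    congr measurable; apply/seteqP; split => w /= D; apply: contra_not D.
      by move=> ->; rewrite subrr.
    by move/eqP; rewrite subr_eq0 => /eqP.
  rewrite QE; apply: eseries0 => n _ _.
  apply: integral0_eq => g /= hg; apply: contrapT => s0; apply: hg.
  by rewrite (hE n)//; apply/eqP => s00; apply: s0; rewrite s00.
Qed.

End scheme.

Theorem theorem3 (R : realType) (d : nat) (hd : (1 <= d)%N)
    (mu : probability (config d) R)
    (hinv : translation_invariant mu) (herg : ergodic mu)
    (hp : (0 < mu (head_at0 d) < 1)%E) :
  (* (i) *)
  (exists (dT : measure_display) (T : measurableType dT) (P : probability T R)
      (Gamma : {RV P >-> config d}) (X : {RV P >-> lattice d}),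
    extra_head_scheme mu Gamma X) /\
  (* (ii) *)
  ((exists (dT : measure_display) (T : measurableType dT) (P : probability T R)
      (Gamma : {RV P >-> config d}) (X : {RV P >-> lattice d}),
    extra_head_scheme mu Gamma X /\ function_of X Gamma) <->
   (exists n : int, n != 0 /\ mu (head_at0 d) = (n%:~R^-1)%:E)) /\
  (* (iii) *)
  (forall (dT : measure_display) (T : measurableType dT) (P : probability T R)
      (Gamma Gammas : {RV P >-> config d}) (X : {RV P >-> lattice d}),
    shift_coupling mu Gamma Gammas X -> ~ function_of X Gammas).
Proof.
have [p mup] : exists p : R, mu (head_at0 d) = p%:E.
  by exists (fine (mu (head_at0 d))); rewrite fineK// fin_num_measure//;
    exact: measurable_head_at0.
move: hp; rewrite mup !lte_fin => /andP[p0 p1].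
have [z [z' _ zK]] := lattice_enum hd.
have zsurj v : exists n, z n = v by exists (z' v).
have [dT [T [P [Gamma [X [scheme fn]]]]]] :=
  greedy_scheme zsurj p0 hinv herg mup.
split; first by exists dT, T, P, Gamma, X.
split; last by move=> *; apply: (not_function_of_shift hd hinv mup p0 p1);
  eassumption.
split.
- move=> [dT' [T' [P' [Gamma' [X' [sch fn']]]]]].
  have [m pm] := reciprocal_of_function hd hinv mup p0 sch fn'.
  exists m%:Z; split; last by rewrite -pmulrn -pm invrK.
  by apply/eqP => m0; move: p0; rewrite -invr_gt0 pm pmulrn m0 ltxx.
- move=> [n [n0 [pn]]].
  have pk : p^-1 = `|n|%N%:R.
    rewrite pn invrK natr_absz gtr0_norm// -(ltr0z R).
    by rewrite -invr_gt0 -pn.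
  have [] := @measurable_selection _ (config d) d z
      (fun k => [set g | sent z p^-1 k g != 0]).
  - move=> k.
    have -> : [set g | sent z p^-1 k g != 0] = sent z p^-1 k @^-1` [set~ 0].
      by apply/seteqP; split => g /= /eqP.
    apply: measurable_preimageT; first exact: measurable_sent.
    by apply: measurableC; exact: measurable_set1.
  - by rewrite pk => i j g /=; exact: sent_nat_uniq.
  move=> h mh hE; exists dT, T, P, Gamma, X; split => //.
  exact: fn mh hE.
Qed.
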